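(* Let $k$ be a field, let $n,m\ge1$, and let $\{p_{ij}\}_{1\le i,j\le n}$ and $\{p'_{ij}\}_{1\le i,j\le m}$ be families of nonzero scalars with $p_{ii}=1$, $p_{ji}=p_{ij}^{-1}$ (and likewise for $p'$), and suppose $p_{ij}\neq1$ for all $i\neq j$ (for the family $p$). Let $A=k_{p_{ij}}[x_1,\dots,x_n]/M$ where $M$ is a graded ideal of $k_{p_{ij}}[x_1,\dots,x_n]$ contained in $k_{p_{ij}}[x_1,\dots,x_n]_{\ge3}$, and let $B=k_{p'_{ij}}[x_1,\dots,x_m]/N$ where $N$ is a graded ideal of $k_{p'_{ij}}[x_1,\dots,x_m]$ contained in $k_{p'_{ij}}[x_1,\dots,x_m]_{\ge2}$. If $A\cong B$ as ungraded algebras, then $n=m$, there is a permutation $\sigma\in S_n$ with $p'_{ij}=p_{\sigma(i)\sigma(j)}$ for all $i,j$, and there are scalars $c_1,\dots,c_n\in k^\times$ such that $x_i\mapsto c_i x_{\sigma(i)}$ defines a graded algebra isomorphism $B\to A$ (i.e. after an elementary change of generators of $A$, $A=B$).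
   Context: The skew polynomial ring $k_{p_{ij}}[x_1,\dots,x_n]$ is the $k$-algebra generated by $x_1,\dots,x_n$ subject to the relations $x_jx_i=p_{ij}x_ix_j$ for all $i,j$; it is graded with each $x_i$ of degree $1$, and $R_{\ge d}$ denotes the span of homogeneous elements of degree $\ge d$. An elementary change of generators replaces the ordered set $\{x_1,\dots,x_n\}$ by $\{a_1x_{\sigma(1)},\dots,a_nx_{\sigma(n)}\}$ with $a_i\in k^\times$ and $\sigma\in S_n$. *)

(* Defs.v *)
(* No multivariate / skew polynomial library is installed, so the
   skew polynomial ring k_p[x_1..x_n] is built here concretely: an element is its
   coefficient function on monomials x^a = x_1^{a_1} ... x_n^{a_n} (a : 'I_n -> nat),
   required to have finite support (sfin).  Multiplication is the twisted convolution
   x^a x^b = twist p a b x^{a+b}, which is exactly what the relations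
   x_j x_i = p_ij x_i x_j give on the ordered monomial basis. *)
From HB Require Import structures.
From mathcomp Require Import all_boot all_order all_algebra.
Set Implicit Arguments. Unset Strict Implicit. Unset Printing Implicit Defensive.
Import Order.TTheory GRing.Theory Num.Theory.
Local Open Scope ring_scope.

Definition mon (n : nat) := {ffun 'I_n -> nat}.
Definition mdeg n (a : mon n) : nat := (\sum_(i < n) a i)%N.
Definition msub n (a b : mon n) : mon n := [ffun i => (a i - b i)%N].
Definition mle n (a b : mon n) : bool := [forall i, (a i <= b i)%N].
Definition mof n N (e : {ffun 'I_n -> 'I_N}) : mon n := [ffun i => nat_of_ord (e i)].

Definition spoly (k : fieldType) (n : nat) := mon n -> k.
Definition sfin (k : fieldType) n (f : spoly k n) : Prop :=
  exists d : nat, forall a, (d < mdeg a)%N -> f a = 0.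

Definition szero (k : fieldType) n : spoly k n := fun _ => 0.
Definition smon (k : fieldType) n (a : mon n) : spoly k n :=
  fun b => if b == a then 1 else 0.
Definition sone (k : fieldType) n : spoly k n := smon k [ffun=> 0%N].
Definition sX (k : fieldType) n (i : 'I_n) : spoly k n :=
  smon k [ffun j => nat_of_bool (j == i)].
Definition sadd (k : fieldType) n (f g : spoly k n) : spoly k n := fun a => f a + g a.
Definition ssub (k : fieldType) n (f g : spoly k n) : spoly k n := fun a => f a - g a.
Definition sscale (k : fieldType) n (c : k) (f : spoly k n) : spoly k n :=
  fun a => c * f a.

(* x^a x^b = twist p a b * x^(a+b) in k_p[x_1..x_n] *)
Definition twist (k : fieldType) n (p : 'I_n -> 'I_n -> k) (a b : mon n) : k :=
  \prod_(i < n) \prod_(j < n | (j < i)%N) p j i ^+ (a i * b j).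

Definition smul (k : fieldType) n (p : 'I_n -> 'I_n -> k) (f g : spoly k n)
  : spoly k n := fun c =>
  \sum_(e : {ffun 'I_n -> 'I_(mdeg c).+1} | mle (mof e) c)
     twist p (mof e) (msub c (mof e)) * f (mof e) * g (msub c (mof e)).

Definition shomog (k : fieldType) n (d : nat) (f : spoly k n) : Prop :=
  forall a, mdeg a != d -> f a = 0.
Definition scomp (k : fieldType) n (d : nat) (f : spoly k n) : spoly k n :=
  fun a => if mdeg a == d then f a else 0.

Definition skew_params (k : fieldType) n (p : 'I_n -> 'I_n -> k) : Prop :=
  [/\ forall i j, p i j != 0, forall i, p i i = 1 & forall i j, p j i = (p i j)^-1].

Record graded_ideal (k : fieldType) n (p : 'I_n -> 'I_n -> k)
    (M : spoly k n -> Prop) : Prop := GradedIdeal {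
  gi_fin : forall f, M f -> sfin f;
  gi_zero : M (@szero k n);
  gi_add : forall f g, M f -> M g -> M (sadd f g);
  gi_scale : forall c f, M f -> M (sscale c f);
  gi_mull : forall f g, sfin g -> M f -> M (smul p g f);
  gi_mulr : forall f g, sfin g -> M f -> M (smul p f g);
  gi_graded : forall d f, M f -> M (scomp d f) }.

Definition ideal_in_ge (k : fieldType) n (d : nat) (M : spoly k n -> Prop) : Prop :=
  forall f, M f -> forall a, (mdeg a < d)%N -> f a = 0.

(* F : k_p[x]/M -> k_p'[x]/N is a bijective (ungraded) k-algebra homomorphism,
   given on representatives: F maps representatives to representatives and all
   identities hold modulo N (resp. M). *)
Record alg_iso_quot (k : fieldType) n m (p : 'I_n -> 'I_n -> k)
    (p' : 'I_m -> 'I_m -> k) (M : spoly k n -> Prop) (N : spoly k m -> Prop)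
    (F : spoly k n -> spoly k m) : Prop := AlgIsoQuot {
  ai_fin : forall f, sfin f -> sfin (F f);
  ai_wd : forall f g, sfin f -> sfin g -> M (ssub f g) -> N (ssub (F f) (F g));
  ai_add : forall f g, sfin f -> sfin g ->
    N (ssub (F (sadd f g)) (sadd (F f) (F g)));
  ai_scale : forall c f, sfin f -> N (ssub (F (sscale c f)) (sscale c (F f)));
  ai_mul : forall f g, sfin f -> sfin g ->
    N (ssub (F (smul p f g)) (smul p' (F f) (F g)));
  ai_one : N (ssub (F (@sone k n)) (@sone k m));
  ai_inj : forall f g, sfin f -> sfin g -> N (ssub (F f) (F g)) -> M (ssub f g);
  ai_surj : forall h, sfin h -> exists2 f, sfin f & N (ssub (F f) h) }.

Definition graded_map (k : fieldType) n m (N : spoly k m -> Prop)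
    (F : spoly k n -> spoly k m) : Prop :=
  forall d f, sfin f -> shomog d f ->
    exists2 g, sfin g /\ shomog d g & N (ssub (F f) g).

(* Main.v *)
(* An isomorphism F : A -> B yields, through the constant and the linear coefficients of
   F f (well defined because N lies in degrees >= 2), a character chi of A and
   chi-derivations der_b of A, one for each generator y_b of B; the der_b are linearly
   independent since F is onto.  If chi does not vanish at some x_i, the relations
   x_j x_i = p_ij x_i x_j with p_ij <> 1 make every der_b vanish at the other generators,
   so B has a single generator, and then so has A; in one variable a character that does
   not vanish at x vanishes at no power of x, so M = N = 0.  Otherwise chi is the
   augmentation, so is the character of the inverse G, and the associated graded map of
   G is a graded isomorphism B -> A.  The linear part L' of G is inverse to that of F, and
   the relations y_b y_a = p'_ab y_a y_b, read in degree 2 of A where M vanishes, force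
   each row of L' to have a single nonzero entry as the p_ij (i <> j) differ from 1.
   Hence L' is a monomial matrix, which gives sigma, the scalars c_i and
   p'_ij = p_sigma(i)sigma(j). *)

Require Import Defs.
From HB Require Import structures.
From mathcomp Require Import all_boot all_order all_algebra.
From mathcomp Require Import ring zify.
From Stdlib Require Import ClassicalEpsilon FunctionalExtensionality.
Set Implicit Arguments. Unset Strict Implicit. Unset Printing Implicit Defensive.
Import GRing.Theory.
Local Open Scope ring_scope.

Section Monomials.
Variable n : nat.
Implicit Types a b c : mon n.

Definition mzero : mon n := [ffun=> 0%N].
Definition mbasis (i : 'I_n) : mon n := [ffun j => nat_of_bool (j == i)].
Definition madd a b : mon n := [ffun i => (a i + b i)%N].

Lemma mleP a b : reflect (forall i, a i <= b i)%N (mle a b).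
Proof. exact: forallP. Qed.

Lemma mdegD a b : mdeg (madd a b) = (mdeg a + mdeg b)%N.
Proof. by rewrite /mdeg -big_split /=; apply: eq_bigr => i _; rewrite ffunE. Qed.

Lemma mdeg_mzero : mdeg mzero = 0%N.
Proof. by rewrite /mdeg big1 // => i _; rewrite ffunE. Qed.

Lemma mdeg_mbasis i : mdeg (mbasis i) = 1%N.
Proof.
rewrite /mdeg (bigD1 i) //= big1 ?ffunE ?eqxx // => j /negbTE ji.
by rewrite ffunE ji.
Qed.

Lemma mdeg_eq0 a : mdeg a = 0%N -> a = mzero.
Proof.
move=> /eqP; rewrite /mdeg sum_nat_eq0 => /forallP a0.
by apply/ffunP => i; rewrite ffunE; apply/eqP; have := a0 i.
Qed.

Lemma leq_mdeg a i : (a i <= mdeg a)%N.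
Proof. by rewrite /mdeg (bigD1 i) //= leq_addr. Qed.

Lemma mdeg_msub a c : mle a c -> mdeg c = (mdeg a + mdeg (msub c a))%N.
Proof.
move=> /mleP ac; rewrite /mdeg -big_split /=; apply: eq_bigr => i _.
by rewrite ffunE subnKC.
Qed.

Lemma msubKC a c : mle a c -> madd a (msub c a) = c.
Proof. by move=> /mleP ac; apply/ffunP => i; rewrite !ffunE subnKC. Qed.

Lemma maddKm a b : msub (madd a b) a = b.
Proof. by apply/ffunP => i; rewrite !ffunE addKn. Qed.

Lemma maddC a b : madd a b = madd b a.
Proof. by apply/ffunP => i; rewrite !ffunE addnC. Qed.

Lemma mle_maddr a b : mle a (madd a b).
Proof. by apply/mleP => i; rewrite ffunE leq_addr. Qed.

Lemma mle_mzero a : mle a mzero -> a = mzero.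
Proof.
by move=> /mleP a0; apply/ffunP => i; have := a0 i; rewrite !ffunE leqn0 => /eqP.
Qed.

Lemma mzero_mle a : mle mzero a.
Proof. by apply/mleP => i; rewrite ffunE. Qed.

Lemma msubm0 a : msub a mzero = a.
Proof. by apply/ffunP => i; rewrite !ffunE subn0. Qed.

Lemma msubmm a : msub a a = mzero.
Proof. by apply/ffunP => i; rewrite !ffunE subnn. Qed.

Lemma mbasis_inj : injective mbasis.
Proof. by move=> i j /ffunP /(_ i); rewrite !ffunE eqxx; case: eqP. Qed.

Lemma mbasis_neq0 i : mbasis i != mzero.
Proof. by apply/eqP => /ffunP /(_ i); rewrite !ffunE eqxx. Qed.

Lemma mdeg_eq1 a : mdeg a = 1%N -> exists i, a = mbasis i.
Proof.
move=> a1.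
have [i ai] : exists i, (0 < a i)%N.
  apply/existsP; apply: contraTT (introT eqP a1) => /existsPn a0.
  by rewrite /mdeg big1 // => i _; have := a0 i; rewrite lt0n negbK => /eqP.
exists i; move: a1; rewrite /mdeg (bigD1 i) //= => a1.
have ai1 : a i = 1%N by apply/eqP; rewrite eqn_leq ai andbT -a1 leq_addr.
move: a1; rewrite ai1 add1n => /eqP; rewrite eqSS sum_nat_eq0 => /forallP a0.
apply/ffunP => j; rewrite ffunE; case: (j =P i) => [->|/eqP ji] //=.
by have := a0 j; rewrite ji /= => /eqP.
Qed.

Lemma mle_mbasis a i : mle a (mbasis i) -> a = mzero \/ a = mbasis i.
Proof.
move=> ai; have := mdeg_msub ai; rewrite mdeg_mbasis.
case da: (mdeg a) => [|[|d]] /=.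
- by left; apply: mdeg_eq0.
- move=> _; right; have [j aj] := mdeg_eq1 da; rewrite aj in ai *.
  by move/mleP: ai => /(_ j); rewrite !ffunE eqxx; case: eqP => // ->.
- lia.
Qed.

Lemma mbasis_le_madd l i j : mle (mbasis l) (madd (mbasis i) (mbasis j)) -> l = i \/ l = j.
Proof.
move/mleP => /(_ l); rewrite !ffunE eqxx.
by case: (l =P i) => [->|_]; [left|case: (l =P j) => [->|//]; right].
Qed.

Lemma mdeg_decomp a : mdeg a <> 0%N ->
  exists i b, a = madd b (mbasis i) /\ mdeg b = (mdeg a).-1.
Proof.
move=> da.
have [i ai] : exists i, (0 < a i)%N.
  case: (boolP [exists i, (0 < a i)%N]) => [/existsP //| /existsPn a0].
  by case: da; rewrite /mdeg big1 // => l _; have := a0 l; rewrite lt0n negbK => /eqP.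
have ia : mle (mbasis i) a by apply/mleP => l; rewrite ffunE; case: eqP => // ->.
exists i, (msub a (mbasis i)); rewrite maddC msubKC //.
by split=> //; have := mdeg_msub ia; rewrite mdeg_mbasis; lia.
Qed.

(* Monomials of degree at most [N] are coded by exponent vectors in ['I_N.+1]. *)
Definition mofi N a : {ffun 'I_n -> 'I_N.+1} := [ffun i => inord (a i)].

Lemma mofiK N a : (forall i, a i <= N)%N -> mof (mofi N a) = a.
Proof. by move=> aN; apply/ffunP => i; rewrite !ffunE inordK // ltnS. Qed.

Lemma mofK N (e : {ffun 'I_n -> 'I_N.+1}) : mofi N (mof e) = e.
Proof. by apply/ffunP => i; rewrite !ffunE inord_val. Qed.

Lemma mofi_mle a c : mle a c -> mof (mofi (mdeg c) a) = a.
Proof. by move=> /mleP ac; apply: mofiK => i; exact: leq_trans (ac i) (leq_mdeg c i). Qed.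

End Monomials.
Arguments mzero {n}.

(** * The skew polynomial ring *)

Lemma big_cond_only1 (R : Type) (idx : R) (op : Monoid.law idx) (I : finType)
    (P : pred I) (F : I -> R) i :
  (forall j, P j -> j != i -> F j = idx) ->
  \big[op/idx]_(j | P j) F j = if P i then F i else idx.
Proof.
move=> Fidx; rewrite big_mkcond (big_only1 i) // => j ji _.
by case: ifP => // /Fidx ->.
Qed.
Arguments big_cond_only1 {R idx op I P F} i.

Lemma big_cond_only2 (R : Type) (idx : R) (op : Monoid.com_law idx) (I : finType)
    (P : pred I) (F : I -> R) i1 i2 : i1 != i2 ->
  (forall j, P j -> j != i1 -> j != i2 -> F j = idx) ->
  \big[op/idx]_(j | P j) F j = op (if P i1 then F i1 else idx) (if P i2 then F i2 else idx).
Proof.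
move=> i12 Fidx; rewrite big_mkcond (bigD1 i1) //= (bigD1 i2) 1?eq_sym //=.
rewrite big1 ?Monoid.mulm1 // => j /andP [j2 j1].
by case: ifP => // Pj; rewrite Fidx.
Qed.
Arguments big_cond_only2 {R idx op I P F} i1 i2.

Section SkewPolynomials.
Variables (k : fieldType) (n : nat).
Implicit Types (f g h : spoly k n) (a b c : mon n).

Lemma spoly_ext f g : (forall a, f a = g a) -> f = g.
Proof. exact: functional_extensionality. Qed.

Lemma smonE a b : smon k a b = if b == a then 1 else 0.
Proof. by []. Qed.

Lemma sXE (i j : 'I_n) : sX k i (mbasis j) = (i == j)%:R.
Proof.
by rewrite /sX smonE; case: (i =P j) => [->|ij]; [rewrite eqxx|case: eqP => // /mbasis_inj /esym].
Qed.

Lemma sfin0 : sfin (@szero k n). Proof. by exists 0%N. Qed.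

Lemma sfin_smon a : sfin (smon k a).
Proof. by exists (mdeg a) => b; rewrite smonE; case: eqP => // ->; rewrite ltnn. Qed.

Lemma sfinD f g : sfin f -> sfin g -> sfin (sadd f g).
Proof.
move=> [d1 f0] [d2 g0]; exists (maxn d1 d2) => a; rewrite gtn_max => /andP [a1 a2].
by rewrite /sadd f0 ?g0 ?addr0.
Qed.

Lemma sfinB f g : sfin f -> sfin g -> sfin (ssub f g).
Proof.
move=> [d1 f0] [d2 g0]; exists (maxn d1 d2) => a; rewrite gtn_max => /andP [a1 a2].
by rewrite /ssub f0 ?g0 ?subr0.
Qed.

Lemma sfinZ x f : sfin f -> sfin (sscale x f).
Proof. by move=> [d f0]; exists d => a da; rewrite /sscale f0 ?mulr0. Qed.

Lemma sfin_scomp d f : sfin (scomp d f).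
Proof. by exists d => a; rewrite /scomp; case: eqP => // ->; rewrite ltnn. Qed.

Lemma sfin_ind (P : spoly k n -> Prop) :
  P (@szero k n) ->
  (forall f g, sfin f -> sfin g -> P f -> P g -> P (sadd f g)) ->
  (forall x a, P (sscale x (smon k a))) ->
  forall f, sfin f -> P f.
Proof.
move=> P0 PD PZ f [d f0].
pose S (r : seq {ffun 'I_n -> 'I_d.+1}) := fun a : mon n =>
  \sum_(e <- r | (mdeg (mof e) <= d)%N) f (mof e) * smon k (mof e) a.
have PS r : sfin (S r) /\ P (S r).
  elim: r => [|e r [Sr PSr]].
    have -> : S [::] = @szero k n by apply: spoly_ext => a; rewrite /S big_nil.
    by split; [exact: sfin0|].
  case: (boolP (mdeg (mof e) <= d)%N) => de.
    have -> : S (e :: r) = sadd (sscale (f (mof e)) (smon k (mof e))) (S r).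
      by apply: spoly_ext => a; rewrite /S big_cons de.
    have fe : sfin (sscale (f (mof e)) (smon k (mof e))) by apply: sfinZ; exact: sfin_smon.
    by split; [exact: sfinD|exact: PD].
  by have -> : S (e :: r) = S r by apply: spoly_ext => a; rewrite /S big_cons (negbTE de).
suff -> : f = S (index_enum _) by case: (PS (index_enum _)).
apply: spoly_ext => a; rewrite /S.
rewrite (big_cond_only1 (mofi d a)); last first.
  move=> e _ ea; rewrite smonE; case: eqP => [ae|_]; last by rewrite mulr0.
  by move: ea; rewrite ae mofK eqxx.
case: (leqP (mdeg a) d) => da.
  by rewrite mofiK ?da ?smonE ?eqxx ?mulr1 // => i; exact: leq_trans (leq_mdeg a i) da.
rewrite f0 //; case: ifP => // dle; rewrite smonE; case: eqP => [ea|]; last by rewrite mulr0.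
by move: dle; rewrite -ea leqNgt da.
Qed.

Definition sge r f := forall a, (mdeg a < r)%N -> f a = 0.

Lemma sge_le d e f : (d <= e)%N -> sge e f -> sge d f.
Proof. by move=> de f0 a da; apply: f0; exact: leq_trans da de. Qed.

Lemma sgeD r f g : sge r f -> sge r g -> sge r (sadd f g).
Proof. by move=> f0 g0 a da; rewrite /sadd f0 ?g0 ?addr0. Qed.

Lemma sgeZ r x f : sge r f -> sge r (sscale x f).
Proof. by move=> f0 a da; rewrite /sscale f0 ?mulr0. Qed.

Lemma sge_scomp d f : sge d (scomp d f).
Proof. by move=> a; rewrite /scomp; case: eqP => // ->; rewrite ltnn. Qed.

Lemma scomp_id d f : shomog d f -> scomp d f = f.
Proof. by move=> fd; apply: spoly_ext => a; rewrite /scomp; case: eqP => // /eqP /fd. Qed.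

Lemma scomp_sge d f : sge d.+1 f -> scomp d f = @szero k n.
Proof. by move=> f0; apply: spoly_ext => a; rewrite /scomp; case: eqP => // da; rewrite f0 ?da. Qed.

Lemma scompB d f g : scomp d (ssub f g) = ssub (scomp d f) (scomp d g).
Proof. by apply: spoly_ext => a; rewrite /scomp /ssub; case: ifP => //; rewrite subrr. Qed.

Lemma scompD d f g : scomp d (sadd f g) = sadd (scomp d f) (scomp d g).
Proof. by apply: spoly_ext => a; rewrite /scomp /sadd; case: ifP => //; rewrite addr0. Qed.

Lemma scompZ d x f : scomp d (sscale x f) = sscale x (scomp d f).
Proof. by apply: spoly_ext => a; rewrite /scomp /sscale; case: ifP => //; rewrite mulr0. Qed.

Lemma scomp_idem d f : scomp d (scomp d f) = scomp d f.
Proof. by apply: spoly_ext => a; rewrite /scomp; case: (mdeg a == d). Qed.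

Lemma scomp_neq d e f : d != e -> scomp d (scomp e f) = @szero k n.
Proof. by move=> de; apply: spoly_ext => a; rewrite /scomp; case: eqP => // ->; rewrite (negbTE de). Qed.

Lemma scomp0 d : scomp d (@szero k n) = @szero k n.
Proof. by apply: spoly_ext => a; rewrite /scomp; case: (mdeg a == d). Qed.

Variable p : 'I_n -> 'I_n -> k.

Lemma smul_monl a g c :
  smul p (smon k a) g c = if mle a c then twist p a (msub c a) * g (msub c a) else 0.
Proof.
rewrite /smul (big_cond_only1 (mofi (mdeg c) a)); last first.
  move=> e _ ea; rewrite smonE; case: eqP => [ea'|_]; last by rewrite mulr0 mul0r.
  by move: ea; rewrite -ea' mofK eqxx.
case: (boolP (mle a c)) => ac; first by rewrite mofi_mle // ac smonE eqxx mulr1.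
case: ifP => // le_ac; rewrite smonE; case: eqP => [ea|]; last by rewrite mulr0 mul0r.
by move: le_ac; rewrite ea (negbTE ac).
Qed.

Lemma smul_smon a b :
  smul p (smon k a) (smon k b) = sscale (twist p a b) (smon k (madd a b)).
Proof.
apply: spoly_ext => c; rewrite smul_monl /sscale !smonE.
case: (c =P madd a b) => [->|cab]; first by rewrite mle_maddr maddKm eqxx.
case: ifP => ac; last by rewrite mulr0.
by case: (msub c a =P b) => [eb|_]; [case: cab; rewrite -eb msubKC|rewrite !mulr0].
Qed.

Lemma smulBl f g h : smul p (ssub f g) h = ssub (smul p f h) (smul p g h).
Proof. by apply: spoly_ext => c; rewrite /smul /ssub -sumrB; apply: eq_bigr => e _; ring. Qed.

Lemma smulBr f g h : smul p f (ssub g h) = ssub (smul p f g) (smul p f h).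
Proof. by apply: spoly_ext => c; rewrite /smul /ssub -sumrB; apply: eq_bigr => e _; ring. Qed.

Lemma smul_eq0_at f g c :
  (forall a, mle a c -> f a * g (msub c a) = 0) -> smul p f g c = 0.
Proof. by move=> fg0; rewrite /smul big1 // => e ec; rewrite -mulrA fg0 ?mulr0. Qed.

Lemma sfinM f g : sfin f -> sfin g -> sfin (smul p f g).
Proof.
move=> [d1 f0] [d2 g0]; exists (d1 + d2)%N => c dc; apply: smul_eq0_at => a ac.
move: dc; rewrite (mdeg_msub ac) => dc.
case: (leqP (mdeg a) d1) => da; last by rewrite f0 ?mul0r.
by rewrite g0 ?mulr0 //; lia.
Qed.

Lemma smul_sge r s f g : sge r f -> sge s g -> sge (r + s) (smul p f g).
Proof.
move=> f0 g0 c dc; apply: smul_eq0_at => a ac.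
move: dc; rewrite (mdeg_msub ac) => dc.
case: (ltnP (mdeg a) r) => da; first by rewrite f0 ?mul0r.
by rewrite g0 ?mulr0 //; lia.
Qed.

Lemma smul_at1 f g c a :
  mle a c -> (forall a', mle a' c -> a' != a -> f a' * g (msub c a') = 0) ->
  smul p f g c = twist p a (msub c a) * f a * g (msub c a).
Proof.
move=> ac fg0; rewrite /smul (big_cond_only1 (mofi (mdeg c) a)).
  by rewrite mofi_mle // ac.
move=> e ec ea; rewrite -mulrA fg0 ?mulr0 //.
by apply: contra ea => /eqP <-; rewrite mofK.
Qed.

Lemma smul_at2 f g c a1 a2 : a1 != a2 -> mle a1 c -> mle a2 c ->
  (forall a', mle a' c -> a' != a1 -> a' != a2 -> f a' * g (msub c a') = 0) ->
  smul p f g c = twist p a1 (msub c a1) * f a1 * g (msub c a1)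
               + twist p a2 (msub c a2) * f a2 * g (msub c a2).
Proof.
move=> a12 a1c a2c fg0.
rewrite /smul (big_cond_only2 (mofi (mdeg c) a1) (mofi (mdeg c) a2)).
- by rewrite !mofi_mle // a1c a2c.
- by apply: contra a12 => /eqP /(congr1 (@mof n _)); rewrite !mofi_mle // => ->.
move=> e ec e1 e2; rewrite -mulrA fg0 ?mulr0 //.
  by apply: contra e1 => /eqP <-; rewrite mofK.
by apply: contra e2 => /eqP <-; rewrite mofK.
Qed.

Lemma twist0l b : twist p mzero b = 1.
Proof.
by rewrite /twist big1 // => i _; rewrite big1 // => j _; rewrite ffunE mul0n expr0.
Qed.

Lemma twist0r a : twist p a mzero = 1.
Proof.
by rewrite /twist big1 // => i _; rewrite big1 // => j _; rewrite ffunE muln0 expr0.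
Qed.

Lemma twist_mbasis i j : twist p (mbasis i) (mbasis j) = if (j < i)%N then p j i else 1.
Proof.
rewrite /twist (bigD1 i) //= [X in _ * X]big1 ?mulr1; last first.
  by move=> l li; rewrite big1 // => l' _; rewrite !ffunE (negbTE li) mul0n expr0.
case: ifP => ji.
  rewrite (bigD1 j) //= big1 ?mulr1; first by rewrite !ffunE !eqxx expr1.
  by move=> l /andP [_ /negbTE lj]; rewrite !ffunE lj eqxx muln0 expr0.
rewrite big1 // => l li; rewrite !ffunE eqxx mul1n.
by case: (l =P j) => [el|_]; [move: li ji; rewrite el => ->|rewrite expr0].
Qed.

Lemma twist_neq0 a b : (forall i j, p i j != 0) -> twist p a b != 0.
Proof.
move=> p_neq0; rewrite /twist; apply/prodf_neq0 => i _; apply/prodf_neq0 => j _.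
exact: expf_neq0.
Qed.

Lemma smul_at_mzero f g : smul p f g mzero = f mzero * g mzero.
Proof.
rewrite (@smul_at1 _ _ _ mzero) ?mzero_mle ?msubm0 ?twist0l ?mul1r //.
by move=> a' /mle_mzero ->; rewrite eqxx.
Qed.

Lemma smul_at_mbasis f g l :
  smul p f g (mbasis l) = f (mbasis l) * g mzero + f mzero * g (mbasis l).
Proof.
rewrite (@smul_at2 _ _ _ (mbasis l) mzero) ?mzero_mle ?msubmm ?msubm0 ?twist0l ?twist0r
  ?mul1r ?mbasis_neq0 //; first by apply/mleP.
by move=> a' /mle_mbasis [] ->; rewrite eqxx.
Qed.

Lemma smul_at_quad f g i j : sge 1 f -> sge 1 g -> i != j ->
  smul p f g (madd (mbasis i) (mbasis j)) =
    twist p (mbasis i) (mbasis j) * f (mbasis i) * g (mbasis j)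
  + twist p (mbasis j) (mbasis i) * f (mbasis j) * g (mbasis i).
Proof.
move=> f0 g0 ij.
have mji : msub (madd (mbasis i) (mbasis j)) (mbasis j) = mbasis i by rewrite maddC maddKm.
rewrite (@smul_at2 _ _ _ (mbasis i) (mbasis j)) ?maddKm ?mji ?mle_maddr //.
- by apply: contra ij => /eqP /mbasis_inj ->.
- by rewrite maddC mle_maddr.
move=> a' a'ij a'i a'j; have := mdeg_msub a'ij; rewrite mdegD !mdeg_mbasis.
case da: (mdeg a') => [|[|d]] /= dc.
- by rewrite f0 ?mul0r // da.
- have [l el] := mdeg_eq1 da; rewrite el in a'ij a'i a'j.
  by case: (mbasis_le_madd a'ij) => li; [move: a'i|move: a'j]; rewrite li eqxx.
- by rewrite g0 ?mulr0 //; lia.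
Qed.

Lemma smul_at_sq f g i : sge 1 f -> sge 1 g ->
  smul p f g (madd (mbasis i) (mbasis i)) = f (mbasis i) * g (mbasis i).
Proof.
move=> f0 g0; rewrite (@smul_at1 _ _ _ (mbasis i)) ?maddKm ?twist_mbasis ?ltnn ?mul1r
  ?mle_maddr //.
move=> a' a'ii a'i; have := mdeg_msub a'ii; rewrite mdegD !mdeg_mbasis.
case da: (mdeg a') => [|[|d]] /= dc.
- by rewrite f0 ?mul0r // da.
- have [l el] := mdeg_eq1 da; rewrite el in a'ii a'i.
  by case: (mbasis_le_madd a'ii) => li; move: a'i; rewrite li eqxx.
- by rewrite g0 ?mulr0 //; lia.
Qed.

Lemma scomp_smul_sge i j f g : sge i f -> sge j g ->
  scomp (i + j) (smul p f g) = smul p (scomp i f) (scomp j g).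
Proof.
move=> f0 g0; apply: spoly_ext => c; rewrite /scomp.
case: eqP => dc.
  rewrite /smul; apply: eq_bigr => e ec; have := mdeg_msub ec.
  case: (ltngtP (mdeg (mof e)) i) => de dce.
  - by rewrite f0 // !mulr0 !mul0r.
  - by rewrite (g0 (msub c (mof e))) ?mulr0 ?mul0r //; lia.
  - have -> : mdeg (msub c (mof e)) = j by lia.
    by rewrite eqxx.
apply/esym/smul_eq0_at => a ac.
case: eqP => da; last by rewrite mul0r.
by case: eqP => dca; [have := mdeg_msub ac; lia|rewrite mulr0].
Qed.

Lemma scomp_smul d f g :
  scomp d (smul p f g) = fun c => \sum_(i < d.+1) smul p (scomp i f) (scomp (d - i) g) c.
Proof.
apply: spoly_ext => c; rewrite /scomp.
case: eqP => dc.
  rewrite /smul exchange_big /=; apply: eq_bigr => e ec; have := mdeg_msub ec => dce.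
  rewrite (big_cond_only1 (inord (mdeg (mof e)))) /=.
    rewrite inordK; last by lia.
    have -> : mdeg (msub c (mof e)) = (d - mdeg (mof e))%N by lia.
    by rewrite !eqxx.
  move=> i _ ie; case: eqP => de; last by rewrite mulr0 mul0r.
  by move: ie; rewrite de inord_val eqxx.
rewrite big1 // => i _; apply: smul_eq0_at => a ac.
case: eqP => da; last by rewrite mul0r.
case: eqP => dca; last by rewrite mulr0.
by have := mdeg_msub ac; have := ltn_ord i; lia.
Qed.

Hypothesis p_neq0 : forall i j, p i j != 0.

Lemma smon_madd a i :
  smon k (madd a (mbasis i)) = sscale (twist p a (mbasis i))^-1 (smul p (smon k a) (sX k i)).
Proof.
apply: spoly_ext => x; rewrite smul_smon /sscale mulrA mulVf ?mul1r //.
exact: twist_neq0.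
Qed.

End SkewPolynomials.

Definition eqmod (k : fieldType) n (I : spoly k n -> Prop) (f g : spoly k n) : Prop :=
  I (ssub f g).

Lemma eqmod_coef_low (k : fieldType) n r (I : spoly k n -> Prop) (f g : spoly k n) a :
  ideal_in_ge r I -> eqmod I f g -> (mdeg a < r)%N -> f a = g a.
Proof. by move=> Ir fg da; apply/eqP; rewrite -subr_eq0; apply/eqP; exact: Ir fg a da. Qed.

Section SkewParams.
Variables (k : fieldType) (n : nat) (p : 'I_n -> 'I_n -> k).
Hypothesis Hp : skew_params p.

Lemma skew_neq0 i j : p i j != 0. Proof. by case: Hp. Qed.
Lemma skew_diag i : p i i = 1. Proof. by case: Hp. Qed.
Lemma skew_inv i j : p j i = (p i j)^-1. Proof. by case: Hp. Qed.

Lemma twist_mbasisC i j : twist p (mbasis j) (mbasis i) = p i j * twist p (mbasis i) (mbasis j).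
Proof.
rewrite !twist_mbasis; case: (ltngtP i j) => ij.
- by rewrite mulr1.
- by rewrite skew_inv mulVf ?skew_neq0.
- by rewrite (val_inj ij) skew_diag mulr1.
Qed.

Lemma smulXC i j : smul p (sX k j) (sX k i) = sscale (p i j) (smul p (sX k i) (sX k j)).
Proof.
rewrite !smul_smon maddC twist_mbasisC.
by apply: spoly_ext => a; rewrite /sscale mulrA.
Qed.

End SkewParams.

Section GradedIdeal.
Variables (k : fieldType) (n : nat) (p : 'I_n -> 'I_n -> k) (I : spoly k n -> Prop).
Hypothesis HI : graded_ideal p I.
Implicit Types (f g h : spoly k n).
Local Notation eqI := (eqmod I).

Lemma ideal_ext f g : I f -> (forall a, f a = g a) -> I g.
Proof. by move=> If /spoly_ext <-. Qed.

Lemma ideal_sfin f : I f -> sfin f. Proof. exact: (gi_fin HI). Qed.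

Lemma eqmod_refl f : eqI f f.
Proof. by apply: (ideal_ext (gi_zero HI)) => a; rewrite /ssub subrr. Qed.

Lemma eqmod_eq f g : f = g -> eqI f g.
Proof. by move=> ->; apply: eqmod_refl. Qed.

Lemma eqmod_sym f g : eqI f g -> eqI g f.
Proof. by move=> fg; apply: (ideal_ext (gi_scale HI (-1) fg)) => a; rewrite /sscale /ssub; ring. Qed.

Lemma eqmod_trans f g h : eqI f g -> eqI g h -> eqI f h.
Proof. by move=> fg gh; apply: (ideal_ext (gi_add HI fg gh)) => a; rewrite /sadd /ssub; ring. Qed.

Lemma eqmodD f f' g g' : eqI f f' -> eqI g g' -> eqI (sadd f g) (sadd f' g').
Proof. by move=> ff gg; apply: (ideal_ext (gi_add HI ff gg)) => a; rewrite /sadd /ssub; ring. Qed.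

Lemma eqmodZ x f f' : eqI f f' -> eqI (sscale x f) (sscale x f').
Proof. by move=> ff; apply: (ideal_ext (gi_scale HI x ff)) => a; rewrite /sscale /ssub; ring. Qed.

Lemma eqmod_scomp d f f' : eqI f f' -> eqI (scomp d f) (scomp d f').
Proof. by move=> ff; rewrite /eqmod -scompB; exact: (gi_graded HI). Qed.

Lemma eqmodM f f' g g' : sfin f' -> sfin g ->
  eqI f f' -> eqI g g' -> eqI (smul p f g) (smul p f' g').
Proof.
move=> ff' fg ff gg.
have If := gi_mulr HI fg ff; have Ig := gi_mull HI ff' gg.
by apply: (ideal_ext (gi_add HI If Ig)) => a; rewrite smulBl smulBr /sadd /ssub; ring.
Qed.

Lemma eqmod_sum (T : Type) (r : seq T) (F G : T -> spoly k n) :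
  (forall t, eqI (F t) (G t)) ->
  eqI (fun a => \sum_(t <- r) F t a) (fun a => \sum_(t <- r) G t a).
Proof.
move=> FG; elim: r => [|t r IH].
  by apply: eqmod_eq; apply: spoly_ext => a; rewrite !big_nil.
by apply: (ideal_ext (gi_add HI (FG t) IH)) => a; rewrite /sadd /ssub !big_cons; ring.
Qed.

Lemma ideal_of_scomp h : sfin h -> (forall d, I (scomp d h)) -> I h.
Proof.
move=> [B h0] Ih.
pose S N := fun a : mon n => if (mdeg a < N)%N then h a else 0.
have IS N : I (S N).
  elim: N => [|N IH]; first by apply: (ideal_ext (gi_zero HI)) => a; rewrite /S ltn0.
  apply: (ideal_ext (gi_add HI IH (Ih N))) => a; rewrite /S /sadd /scomp ltnS.
  by case: (ltngtP (mdeg a) N); rewrite ?addr0 ?add0r.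
by apply: (ideal_ext (IS B.+1)) => a; rewrite /S; case: ltnP => // /h0.
Qed.

End GradedIdeal.

Section InverseIso.
Variables (k : fieldType) (s t : nat) (ps : 'I_s -> 'I_s -> k) (pt : 'I_t -> 'I_t -> k).
Variables (IS : spoly k s -> Prop) (IT : spoly k t -> Prop) (Phi : spoly k s -> spoly k t).
Hypotheses (HT : graded_ideal pt IT) (HPhi : alg_iso_quot ps pt IS IT Phi).
Local Notation eqS := (eqmod IS).
Local Notation eqT := (eqmod IT).

Lemma alg_iso_quot_inv : exists Psi : spoly k t -> spoly k s,
  [/\ alg_iso_quot pt ps IT IS Psi,
      forall h, sfin h -> eqT (Phi (Psi h)) h &
      forall f, sfin f -> eqS (Psi (Phi f)) f].
Proof.
pose Psi h := epsilon (inhabits (@szero k s)) (fun f => sfin f /\ eqT (Phi f) h).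
have PsiP h : sfin h -> sfin (Psi h) /\ eqT (Phi (Psi h)) h.
  move=> fh; apply: (epsilon_spec _ (fun f => sfin f /\ eqT (Phi f) h)).
  by have [f ff e] := ai_surj HPhi fh; exists f.
have fPsi h fh := (PsiP h fh).1; have PhiPsi h fh := (PsiP h fh).2.
have fPhi := ai_fin HPhi.
have Phi_inj : forall f g, sfin f -> sfin g -> eqT (Phi f) (Phi g) -> eqS f g.
  exact: ai_inj HPhi.
have PsiPhi f : sfin f -> eqS (Psi (Phi f)) f.
  by move=> ff; apply: Phi_inj => //; [apply: fPsi; exact: fPhi|apply: PhiPsi; exact: fPhi].
exists Psi; split=> //; split=> //.
- move=> f g ff fg fg_eq; apply: Phi_inj; [exact: fPsi|exact: fPsi|].
  apply: (eqmod_trans HT (PhiPsi _ ff)); apply: (eqmod_trans HT fg_eq).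
  by apply: (eqmod_sym HT); exact: PhiPsi.
- move=> f g ff fg; apply: Phi_inj; [apply: fPsi; exact: sfinD|by apply: sfinD; exact: fPsi|].
  apply: (eqmod_trans HT (PhiPsi _ (sfinD ff fg))); apply: (eqmod_sym HT).
  apply: (eqmod_trans HT (ai_add HPhi (fPsi _ ff) (fPsi _ fg))).
  exact: (eqmodD HT (PhiPsi _ ff) (PhiPsi _ fg)).
- move=> x f ff; apply: Phi_inj; [apply: fPsi; exact: sfinZ|by apply: sfinZ; exact: fPsi|].
  apply: (eqmod_trans HT (PhiPsi _ (sfinZ x ff))); apply: (eqmod_sym HT).
  apply: (eqmod_trans HT (ai_scale HPhi x (fPsi _ ff))).
  exact: (eqmodZ HT x (PhiPsi _ ff)).
- move=> f g ff fg; apply: Phi_inj; [apply: fPsi; exact: sfinM|by apply: sfinM; exact: fPsi|].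
  apply: (eqmod_trans HT (PhiPsi _ (sfinM pt ff fg))); apply: (eqmod_sym HT).
  apply: (eqmod_trans HT (ai_mul HPhi (fPsi _ ff) (fPsi _ fg))).
  by apply: (eqmodM HT) => //; [apply: fPhi; exact: fPsi|exact: PhiPsi|exact: PhiPsi].
- have f1 := sfin_smon k (@mzero t).
  apply: Phi_inj; [exact: fPsi|exact: sfin_smon|].
  by apply: (eqmod_trans HT (PhiPsi _ f1)); apply: (eqmod_sym HT); exact: (ai_one HPhi).
- move=> f g ff fg fg_eq; apply: (eqmod_trans HT (eqmod_sym HT (PhiPsi _ ff))).
  by apply: (eqmod_trans HT _ (PhiPsi _ fg)); apply: (ai_wd HPhi) => //; exact: fPsi.
- by move=> f ff; exists (Phi f); [exact: fPhi|exact: PsiPhi].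
Qed.

End InverseIso.

(** * Characters and derivations *)

Section CharactersAndDerivations.
Variables (k : fieldType) (n : nat) (p : 'I_n -> 'I_n -> k).
Hypothesis p_neq0 : forall i j, p i j != 0.
Variables (chi D : spoly k n -> k).
Hypothesis chi1 : chi (@sone k n) = 1.

Lemma smul1 : smul p (@sone k n) (@sone k n) = @sone k n.
Proof.
rewrite /sone smul_smon twist0l; apply: spoly_ext => a; rewrite /sscale mul1r.
by congr smon; apply/ffunP => i; rewrite !ffunE.
Qed.

Let linear_eq0 (L : spoly k n -> k) :
  (forall f g, sfin f -> sfin g -> L (sadd f g) = L f + L g) ->
  (forall x f, sfin f -> L (sscale x f) = x * L f) ->
  (forall a, L (smon k a) = 0) -> forall f, sfin f -> L f = 0.
Proof.
move=> LD LZ Lmon; apply: sfin_ind => [|f g ff fg Lf Lg|x a].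
- have -> : @szero k n = sscale 0 (@szero k n).
    by apply: spoly_ext => a; rewrite /sscale mul0r.
  by rewrite LZ ?mul0r //; exact: sfin0.
- by rewrite LD // Lf Lg addr0.
- by rewrite LZ ?Lmon ?mulr0 //; exact: sfin_smon.
Qed.

Lemma derivation_eq0 :
  (forall f g, sfin f -> sfin g -> D (sadd f g) = D f + D g) ->
  (forall x f, sfin f -> D (sscale x f) = x * D f) ->
  (forall f g, sfin f -> sfin g -> D (smul p f g) = D f * chi g + chi f * D g) ->
  (forall i, D (sX k i) = 0) -> forall f, sfin f -> D f = 0.
Proof.
move=> DD DZ DM DX; apply: linear_eq0 => // a.
elim: {a}(mdeg a) {-2}a (erefl (mdeg a)) => [|d IH] a da.
  rewrite (mdeg_eq0 da) -/(@sone k n).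
  have := DM _ _ (sfin_smon k mzero) (sfin_smon k mzero).
  rewrite smul1 chi1 mulr1 mul1r => D11.
  by apply: (@addrI _ (D (@sone k n))); rewrite -D11 addr0.
have [|i [b [eab db]]] := mdeg_decomp (a := a); first by rewrite da.
have fb := sfin_smon k b; have fX := sfin_smon k (mbasis i).
have fbX : sfin (smul p (smon k b) (sX k i)) by exact: sfinM.
rewrite eab (smon_madd p_neq0) DZ // DM // DX (IH b); first by rewrite mul0r mulr0 addr0 mulr0.
by rewrite db da.
Qed.

Lemma character_augmentation :
  (forall f g, sfin f -> sfin g -> chi (sadd f g) = chi f + chi g) ->
  (forall x f, sfin f -> chi (sscale x f) = x * chi f) ->
  (forall f g, sfin f -> sfin g -> chi (smul p f g) = chi f * chi g) ->
  (forall i, chi (sX k i) = 0) -> forall f, sfin f -> chi f = f mzero.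
Proof.
move=> chiD chiZ chiM chiX f ff.
suff: chi f - f mzero = 0 by move/eqP; rewrite subr_eq0 => /eqP.
move: f ff; apply: linear_eq0 => [f g ff fg|x f ff|a].
- by rewrite chiD // /sadd; ring.
- by rewrite chiZ // /sscale; ring.
rewrite smonE; case da: (mdeg a) => [|d].
  by rewrite (mdeg_eq0 da) eqxx chi1 subrr.
have [|i [b [eab _]]] := mdeg_decomp (a := a); first by rewrite da.
have fb := sfin_smon k b; have fX := sfin_smon k (mbasis i).
have fbX : sfin (smul p (smon k b) (sX k i)) by exact: sfinM.
rewrite {1}eab (smon_madd p_neq0) chiZ // chiM // chiX !mulr0 sub0r.
by case: eqP => [a0|]; [move: da; rewrite -a0 mdeg_mzero|rewrite oppr0].
Qed.

End CharactersAndDerivations.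

Section QuotientIso.
Variables (k : fieldType) (s t : nat) (ps : 'I_s -> 'I_s -> k) (pt : 'I_t -> 'I_t -> k).
Variables (IS : spoly k s -> Prop) (IT : spoly k t -> Prop) (Phi : spoly k s -> spoly k t).
Hypotheses (HS : graded_ideal ps IS) (HT : graded_ideal pt IT)
  (HPhi : alg_iso_quot ps pt IS IT Phi).
Implicit Types (f g : spoly k s).
Local Notation eqT := (eqmod IT).

Lemma Phi_zero : eqT (Phi (@szero k s)) (@szero k t).
Proof.
have e0 n (f : spoly k n) : sscale 0 f = @szero k n.
  by apply: spoly_ext => a; rewrite /sscale mul0r.
by have := ai_scale HPhi 0 (sfin0 k s); rewrite !e0; apply.
Qed.

Lemma Phi_ideal f : IS f -> eqT (Phi f) (@szero k t).
Proof.
move=> If; apply: (eqmod_trans HT _ Phi_zero).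
apply: (ai_wd HPhi); [exact: (ideal_sfin HS If)|exact: sfin0|].
by apply: (ideal_ext If) => a; rewrite /ssub /szero subr0.
Qed.

Lemma Phi_sum (T : Type) (r : seq T) (c : T -> k) (w : T -> spoly k s) :
  (forall x, sfin (w x)) ->
  eqT (Phi (fun a => \sum_(x <- r) c x * w x a)) (fun a => \sum_(x <- r) c x * Phi (w x) a).
Proof.
move=> fw; elim: r => [|x r IH].
  have -> : (fun a => \sum_(x <- [::]) c x * w x a) = @szero k s.
    by apply: spoly_ext => a; rewrite big_nil.
  apply: (eqmod_trans HT Phi_zero); apply: (eqmod_eq HT).
  by apply: spoly_ext => a; rewrite big_nil.
have fr : sfin (fun a => \sum_(x <- r) c x * w x a).
  elim: r {IH} => [|y r [d r0]]; first by exists 0%N => a _; rewrite big_nil.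
  have [d' y0] := fw y; exists (maxn d d') => a; rewrite gtn_max => /andP [ad ad'].
  by rewrite big_cons r0 ?y0 ?mulr0 ?addr0.
have -> : (fun a => \sum_(y <- x :: r) c y * w y a)
        = sadd (sscale (c x) (w x)) (fun a => \sum_(y <- r) c y * w y a).
  by apply: spoly_ext => a; rewrite big_cons.
apply: (eqmod_trans HT (ai_add HPhi (sfinZ _ (fw x)) fr)).
apply: (eqmod_trans HT (eqmodD HT (ai_scale HPhi (c x) (fw x)) IH)).
by apply: (eqmod_eq HT); apply: spoly_ext => a; rewrite big_cons.
Qed.

(* Since IT lies in degrees >= 2, the constant and linear coefficients of [Phi f]
   are well defined: [chi] is a character and each [der b] a [chi]-derivation. *)
Hypothesis HT2 : ideal_in_ge 2 IT.

Definition chi f := Phi f mzero.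
Definition der (b : 'I_t) f := Phi f (mbasis b).

Let coef0_eqmod (u v : spoly k t) : eqT u v -> u mzero = v mzero.
Proof. by move=> uv; apply: (eqmod_coef_low HT2 uv); rewrite mdeg_mzero. Qed.

Lemma coef1_eqmod (u v : spoly k t) b : eqT u v -> u (mbasis b) = v (mbasis b).
Proof. by move=> uv; apply: (eqmod_coef_low HT2 uv); rewrite mdeg_mbasis. Qed.

Lemma chiD f g : sfin f -> sfin g -> chi (sadd f g) = chi f + chi g.
Proof. by move=> ff fg; rewrite /chi (coef0_eqmod (ai_add HPhi ff fg)). Qed.

Lemma chiZ x f : sfin f -> chi (sscale x f) = x * chi f.
Proof. by move=> ff; rewrite /chi (coef0_eqmod (ai_scale HPhi x ff)). Qed.

Lemma chiM f g : sfin f -> sfin g -> chi (smul ps f g) = chi f * chi g.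
Proof. by move=> ff fg; rewrite /chi (coef0_eqmod (ai_mul HPhi ff fg)) smul_at_mzero. Qed.

Lemma chi1 : chi (@sone k s) = 1.
Proof. by rewrite /chi (coef0_eqmod (ai_one HPhi)) /sone smonE eqxx. Qed.

Lemma chi_ideal f : IS f -> chi f = 0.
Proof. by move=> If; rewrite /chi (coef0_eqmod (Phi_ideal If)). Qed.

Lemma derD b f g : sfin f -> sfin g -> der b (sadd f g) = der b f + der b g.
Proof. by move=> ff fg; rewrite /der (coef1_eqmod _ (ai_add HPhi ff fg)). Qed.

Lemma derZ b x f : sfin f -> der b (sscale x f) = x * der b f.
Proof. by move=> ff; rewrite /der (coef1_eqmod _ (ai_scale HPhi x ff)). Qed.

Lemma derM b f g : sfin f -> sfin g ->
  der b (smul ps f g) = der b f * chi g + chi f * der b g.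
Proof. by move=> ff fg; rewrite /der (coef1_eqmod _ (ai_mul HPhi ff fg)) smul_at_mbasis. Qed.

Variable Psi : spoly k t -> spoly k s.
Hypotheses (Psi_fin : forall h, sfin h -> sfin (Psi h))
  (PhiPsi : forall h, sfin h -> eqT (Phi (Psi h)) h).
Hypothesis ps_neq0 : forall i j, ps i j != 0.

Lemma der_Psi (b c : 'I_t) : der b (Psi (sX k c)) = (b == c)%:R.
Proof.
have fX : sfin (sX k c) := sfin_smon k (mbasis c).
by rewrite /der (coef1_eqmod _ (PhiPsi fX)) sXE eq_sym.
Qed.

(* The derivations [der b] are linearly independent, while on generators they are
   all proportional to their values at x_i0; hence there is at most one of them. *)
Lemma embdim_le1 (i0 : 'I_s) :
  (forall b (j : 'I_s), j != i0 -> der b (sX k j) = 0) -> (t <= 1)%N.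
Proof.
move=> der0; rewrite leqNgt; apply/negP => t_gt1.
pose b1 : 'I_t := Ordinal (ltnW t_gt1); pose b2 : 'I_t := Ordinal t_gt1.
have b12 : b1 != b2 by [].
have fPsi b : sfin (Psi (sX k b)) by apply: Psi_fin; exact: sfin_smon.
pose D f := der b1 (sX k i0) * der b2 f - der b2 (sX k i0) * der b1 f.
have D0 : forall f, sfin f -> D f = 0.
  apply: (derivation_eq0 ps_neq0 (chi := chi)).
  - exact: chi1.
  - by move=> f g ff fg; rewrite /D !derD //; ring.
  - by move=> x f ff; rewrite /D !derZ //; ring.
  - by move=> f g ff fg; rewrite /D !derM //; ring.
  - move=> j; rewrite /D; case: (j =P i0) => [->|/eqP ji0]; first by ring.
    by rewrite (der0 b1 j ji0) (der0 b2 j ji0) !mulr0 subrr.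
have := D0 _ (fPsi b1); have := D0 _ (fPsi b2).
rewrite /D !der_Psi !eqxx (negbTE b12) eq_sym (negbTE b12) !mulr0 !mulr1 subr0 sub0r.
move=> der1_0 /eqP; rewrite oppr_eq0 => /eqP der2_0.
have D1 : forall f, sfin f -> der b1 f = 0.
  apply: (derivation_eq0 ps_neq0 (chi := chi)).
  - exact: chi1.
  - exact: derD.
  - exact: derZ.
  - exact: derM.
  - by move=> j; case: (j =P i0) => [->|/eqP ji0]; [exact: der1_0|exact: der0].
by have := D1 _ (fPsi b1); rewrite der_Psi eqxx => /eqP; rewrite oner_eq0.
Qed.

End QuotientIso.

(** * The associated graded isomorphism *)

Section AssociatedGradedMap.
Variables (k : fieldType) (s t : nat) (ps : 'I_s -> 'I_s -> k) (pt : 'I_t -> 'I_t -> k).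
Variables (IS : spoly k s -> Prop) (IT : spoly k t -> Prop) (Phi : spoly k s -> spoly k t).
Hypotheses (HS : graded_ideal ps IS) (HT : graded_ideal pt IT)
  (HPhi : alg_iso_quot ps pt IS IT Phi).
Hypothesis ps_neq0 : forall i j, ps i j != 0.
Hypothesis Phi_aug : forall i, chi Phi (sX k i) = 0.
Implicit Types (f g : spoly k s).
Local Notation eqT := (eqmod IT).

Lemma Phi_smon_sge a :
  exists2 h, sfin h /\ sge (mdeg a) h & eqT (Phi (smon k a)) h.
Proof.
elim: {a}(mdeg a) {-2}a (erefl (mdeg a)) => [|d IH] a da.
  exists (Phi (smon k a)); last exact: (eqmod_refl HT).
  by split; [apply: (ai_fin HPhi); exact: sfin_smon|rewrite da => b; rewrite ltn0].
have [|i [b [eab db]]] := mdeg_decomp (a := a); first by rewrite da.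
subst a.
have [h [fh hb] Phib] : exists2 h, sfin h /\ sge (mdeg b) h & eqT (Phi (smon k b)) h.
  by apply: IH; rewrite db da.
have fb := sfin_smon k b; have fX := sfin_smon k (mbasis i).
have fPX : sfin (Phi (sX k i)) by exact: (ai_fin HPhi).
have PhiX1 : sge 1 (Phi (sX k i)).
  by move=> c; rewrite ltnS leqn0 => /eqP /mdeg_eq0 ->; exact: Phi_aug.
pose x := (twist ps b (mbasis i))^-1.
exists (sscale x (smul pt h (Phi (sX k i)))).
  split; first by apply: sfinZ; exact: sfinM.
  by rewrite mdegD mdeg_mbasis; apply: sgeZ; exact: smul_sge.
rewrite (smon_madd ps_neq0).
apply: (eqmod_trans HT (ai_scale HPhi _ (sfinM _ fb fX))); apply: (eqmodZ HT).
apply: (eqmod_trans HT (ai_mul HPhi fb fX)).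
by apply: (eqmodM HT) => //; exact: (eqmod_refl HT).
Qed.

Lemma Phi_sge d f : sfin f -> sge d f -> exists2 h, sfin h /\ sge d h & eqT (Phi f) h.
Proof.
pose high g := fun a => if (d <= mdeg a)%N then g a else 0.
suff Phi_high : forall g, sfin g -> exists2 h, sfin h /\ sge d h & eqT (Phi (high g)) h.
  move=> ff f0; suff -> : f = high f by exact: Phi_high.
  by apply: spoly_ext => a; rewrite /high; case: leqP => // /f0.
apply: (sfin_ind (P := fun g => exists2 h, sfin h /\ sge d h & eqT (Phi (high g)) h))
  => [|g1 g2 fg1 fg2 [h1 [fh1 h1d] e1] [h2 [fh2 h2d] e2]|x a].
- exists (@szero k t); first by split; [exact: sfin0|move=> b _].
  have -> : high (@szero k s) = @szero k s by apply: spoly_ext => a; rewrite /high if_same.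
  exact: Phi_zero HPhi.
- have fhigh g : sfin g -> sfin (high g).
    by move=> [e u0]; exists e => a ea; rewrite /high u0 ?if_same.
  exists (sadd h1 h2); first by split; [exact: sfinD|exact: sgeD].
  have -> : high (sadd g1 g2) = sadd (high g1) (high g2).
    by apply: spoly_ext => a; rewrite /high /sadd; case: ifP; rewrite ?addr0.
  apply: (eqmod_trans HT (ai_add HPhi (fhigh _ fg1) (fhigh _ fg2))).
  exact: (eqmodD HT).
case: (leqP d (mdeg a)) => da; last first.
  exists (@szero k t); first by split; [exact: sfin0|move=> b _].
  have -> : high (sscale x (smon k a)) = @szero k s.
    apply: spoly_ext => b; rewrite /high /sscale smonE.
    by case: eqP => [->|_]; [rewrite leqNgt da|rewrite mulr0 if_same].
  exact: Phi_zero HPhi.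
have -> : high (sscale x (smon k a)) = sscale x (smon k a).
  apply: spoly_ext => b; rewrite /high /sscale smonE.
  by case: eqP => [->|_]; [rewrite da|rewrite mulr0 if_same].
have [h [fh ha] Phia] := Phi_smon_sge a.
exists (sscale x h); first by split; [exact: sfinZ|apply: sgeZ; exact: sge_le ha].
apply: (eqmod_trans HT (ai_scale HPhi x (sfin_smon k a))).
exact: (eqmodZ HT).
Qed.

Definition grmap f : spoly k t := fun a => Phi (scomp (mdeg a) f) a.

Lemma scomp_grmap d f : scomp d (grmap f) = scomp d (Phi (scomp d f)).
Proof. by apply: spoly_ext => a; rewrite /scomp /grmap; case: eqP => // ->. Qed.

Lemma sfin_grmap f : sfin f -> sfin (grmap f).
Proof.
move=> [df f0]; have [dz z0] := ai_fin HPhi (sfin0 k s).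
exists (maxn df dz) => a; rewrite gtn_max => /andP [adf adz]; rewrite /grmap.
have -> : scomp (mdeg a) f = @szero k s.
  by apply: spoly_ext => b; rewrite /scomp; case: eqP => // ba; rewrite f0 // ba.
by rewrite z0.
Qed.

Lemma grmap_eqmod f (h : spoly k t) : sfin f -> sfin h ->
  (forall d, eqT (scomp d (Phi (scomp d f))) (scomp d h)) -> eqT (grmap f) h.
Proof.
move=> ff fh fh_d; apply: (ideal_of_scomp HT); first by apply: sfinB => //; exact: sfin_grmap.
by move=> d; rewrite scompB scomp_grmap; exact: fh_d.
Qed.

Lemma grmap_wd f g : sfin f -> sfin g -> eqmod IS f g -> eqT (grmap f) (grmap g).
Proof.
move=> ff fg fg_eq; apply: grmap_eqmod => //; first exact: sfin_grmap.
move=> d; rewrite scomp_grmap; apply: (eqmod_scomp HT).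
by apply: (ai_wd HPhi); [exact: sfin_scomp|exact: sfin_scomp|exact: (eqmod_scomp HS)].
Qed.

Lemma grmapD f g : sfin f -> sfin g -> eqT (grmap (sadd f g)) (sadd (grmap f) (grmap g)).
Proof.
move=> ff fg; apply: grmap_eqmod; [exact: sfinD|by apply: sfinD; exact: sfin_grmap|].
move=> d; rewrite [X in eqT _ X]scompD !scomp_grmap -scompD; apply: (eqmod_scomp HT).
by rewrite scompD; apply: (ai_add HPhi); exact: sfin_scomp.
Qed.

Lemma grmapZ x f : sfin f -> eqT (grmap (sscale x f)) (sscale x (grmap f)).
Proof.
move=> ff; apply: grmap_eqmod; [exact: sfinZ|by apply: sfinZ; exact: sfin_grmap|].
move=> d; rewrite [X in eqT _ X]scompZ !scomp_grmap -scompZ; apply: (eqmod_scomp HT).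
by rewrite scompZ; apply: (ai_scale HPhi); exact: sfin_scomp.
Qed.

Lemma grmap_homog d f : sfin f -> shomog d f -> eqT (grmap f) (scomp d (Phi f)).
Proof.
move=> ff fd; apply: grmap_eqmod => //; first exact: sfin_scomp.
move=> e; case: (e =P d) => [->|/eqP ed].
  by rewrite scomp_idem (scomp_id fd); exact: (eqmod_refl HT).
have -> : scomp e f = @szero k s.
  by apply: spoly_ext => a; rewrite /scomp; case: eqP => // ae; rewrite fd // ae.
rewrite scomp_neq //; apply: (eqmod_trans HT (eqmod_scomp HT e (Phi_zero HPhi))).
by rewrite scomp0; exact: (eqmod_refl HT).
Qed.

Lemma grmap1 : eqT (grmap (@sone k s)) (@sone k t).
Proof.
have sone_homog n : shomog 0 (@sone k n).
  by move=> a a0; rewrite /sone smonE; case: eqP => // ea; move: a0; rewrite ea mdeg_mzero.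
apply: (eqmod_trans HT (grmap_homog (sfin_smon k mzero) (sone_homog s))).
by rewrite -{1}(scomp_id (sone_homog t)); apply: (eqmod_scomp HT); exact: (ai_one HPhi).
Qed.

Lemma scomp_Phi_smul i j u v : sfin u -> sfin v -> sge i u -> sge j v ->
  eqT (scomp (i + j) (Phi (smul ps u v))) (smul pt (scomp i (Phi u)) (scomp j (Phi v))).
Proof.
move=> fu fv ui vj.
have [hu [fhu hui] Phiu] := Phi_sge fu ui; have [hv [fhv hvj] Phiv] := Phi_sge fv vj.
have Phiuv : eqT (Phi (smul ps u v)) (smul pt hu hv).
  apply: (eqmod_trans HT (ai_mul HPhi fu fv)).
  by apply: (eqmodM HT) => //; exact: (ai_fin HPhi).
apply: (eqmod_trans HT (eqmod_scomp HT _ Phiuv)); rewrite scomp_smul_sge //.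
apply: (eqmodM HT); [exact: sfin_scomp|exact: sfin_scomp| |];
  by apply: (eqmod_scomp HT); exact: (eqmod_sym HT).
Qed.

Lemma grmapM f g : sfin f -> sfin g -> eqT (grmap (smul ps f g)) (smul pt (grmap f) (grmap g)).
Proof.
move=> ff fg; apply: grmap_eqmod; [exact: sfinM|by apply: sfinM; exact: sfin_grmap|].
move=> d; rewrite !scomp_smul.
pose W (i : 'I_d.+1) := smul ps (scomp i f) (scomp (d - i) g).
have fW i : sfin (W i) by apply: sfinM; exact: sfin_scomp.
have PhiW := Phi_sum HT HPhi (index_enum 'I_d.+1) (fun=> 1) fW.
have -> : (fun c => \sum_(i < d.+1) W i c) = (fun c => \sum_(i < d.+1) 1 * W i c).
  by apply: spoly_ext => c; apply: eq_bigr => i _; rewrite mul1r.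
apply: (eqmod_trans HT (eqmod_scomp HT d PhiW)).
have -> : scomp d (fun a => \sum_(i < d.+1) 1 * Phi (W i) a)
        = (fun a => \sum_(i < d.+1) scomp d (Phi (W i)) a).
  apply: spoly_ext => a; rewrite /scomp; case: ifP => _; last by rewrite big1.
  by apply: eq_bigr => i _; rewrite mul1r.
apply: (eqmod_sum HT) => i; rewrite !scomp_grmap.
have di : (i + (d - i))%N = d by have := ltn_ord i; lia.
by rewrite /W -{1}di; apply: scomp_Phi_smul; first [exact: sfin_scomp|exact: sge_scomp].
Qed.

End AssociatedGradedMap.

Section GradedInverse.
Variables (k : fieldType) (s t : nat) (ps : 'I_s -> 'I_s -> k) (pt : 'I_t -> 'I_t -> k).
Variables (IS : spoly k s -> Prop) (IT : spoly k t -> Prop).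
Variables (Phi : spoly k s -> spoly k t) (Psi : spoly k t -> spoly k s).
Hypotheses (HS : graded_ideal ps IS) (HT : graded_ideal pt IT)
  (HPhi : alg_iso_quot ps pt IS IT Phi) (HPsi : alg_iso_quot pt ps IT IS Psi).
Hypotheses (ps_neq0 : forall i j, ps i j != 0) (pt_neq0 : forall i j, pt i j != 0).
Hypotheses (Phi_aug : forall i, chi Phi (sX k i) = 0) (Psi_aug : forall i, chi Psi (sX k i) = 0).
Hypothesis PhiPsi : forall h, sfin h -> eqmod IT (Phi (Psi h)) h.
Local Notation eqT := (eqmod IT).

Lemma grmapK h : sfin h -> eqT (grmap Phi (grmap Psi h)) h.
Proof.
move=> fh; apply: (grmap_eqmod HT HPhi) => //; first exact: (sfin_grmap HPsi).
move=> d; rewrite scomp_grmap; set u := scomp d h.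
have fu : sfin u by exact: sfin_scomp.
have ud : sge d u by exact: sge_scomp.
have [w [fw wd] Psiu] := Phi_sge HS HPsi pt_neq0 Psi_aug fu ud.
pose w' := ssub w (scomp d w).
have fw' : sfin w' by apply: sfinB => //; exact: sfin_scomp.
have w'd : sge d.+1 w'.
  move=> a da; rewrite /w' /ssub /scomp; case: eqP => [_|ad]; first by rewrite subrr.
  by rewrite wd ?subr0 //; lia.
have [z [fz zd] Phiw'] := Phi_sge HT HPhi ps_neq0 Phi_aug fw' w'd.
have Phiw : eqT (Phi w) (sadd (Phi (scomp d w)) z).
  have ew : w = sadd (scomp d w) w' by apply: spoly_ext => a; rewrite /sadd /w' /ssub; ring.
  rewrite {1}ew; apply: (eqmod_trans HT (ai_add HPhi (sfin_scomp _ _) fw')).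
  exact: (eqmodD HT (eqmod_refl HT _) Phiw').
have uw : eqT u (sadd (Phi (scomp d w)) z).
  apply: (eqmod_trans HT _ Phiw); apply: (eqmod_sym HT); apply: (eqmod_trans HT _ (PhiPsi fu)).
  by apply: (ai_wd HPhi) => //; [exact: (ai_fin HPsi)|exact: (eqmod_sym HS)].
have := eqmod_scomp HT d uw; rewrite scompD (scomp_sge zd) scomp_idem => u_eq.
apply: (eqmod_trans HT _ (eqmod_sym HT u_eq)).
apply: (eqmod_trans HT (g := scomp d (Phi (scomp d w)))).
  apply: (eqmod_scomp HT); apply: (ai_wd HPhi); [exact: sfin_scomp|exact: sfin_scomp|].
  exact: (eqmod_scomp HS).
by apply: (eqmod_eq HT); apply: spoly_ext => a; rewrite /sadd /szero addr0.
Qed.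

End GradedInverse.

Section GradedIso.
Variables (k : fieldType) (s t : nat) (ps : 'I_s -> 'I_s -> k) (pt : 'I_t -> 'I_t -> k).
Variables (IS : spoly k s -> Prop) (IT : spoly k t -> Prop).
Variables (Phi : spoly k s -> spoly k t) (Psi : spoly k t -> spoly k s).
Hypotheses (HS : graded_ideal ps IS) (HT : graded_ideal pt IT)
  (HPhi : alg_iso_quot ps pt IS IT Phi) (HPsi : alg_iso_quot pt ps IT IS Psi).
Hypotheses (ps_neq0 : forall i j, ps i j != 0) (pt_neq0 : forall i j, pt i j != 0).
Hypotheses (Phi_aug : forall i, chi Phi (sX k i) = 0) (Psi_aug : forall i, chi Psi (sX k i) = 0).
Hypotheses (PhiPsi : forall h, sfin h -> eqmod IT (Phi (Psi h)) h)
  (PsiPhi : forall f, sfin f -> eqmod IS (Psi (Phi f)) f).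
Local Notation eqT := (eqmod IT).

Lemma grmap_iso :
  [/\ alg_iso_quot ps pt IS IT (grmap Phi), graded_map IT (grmap Phi) &
      forall i, eqT (grmap Phi (sX k i)) (scomp 1 (Phi (sX k i)))].
Proof.
have sfin_gr := sfin_grmap HPhi.
have grPsiPhi f : sfin f -> eqmod IS (grmap Psi (grmap Phi f)) f.
  exact: (grmapK HT HS HPsi HPhi pt_neq0 ps_neq0 Psi_aug Phi_aug PsiPhi).
have grPhiPsi h : sfin h -> eqT (grmap Phi (grmap Psi h)) h.
  exact: (grmapK HS HT HPhi HPsi ps_neq0 pt_neq0 Phi_aug Psi_aug PhiPsi).
split; first split.
- exact: sfin_gr.
- exact: (grmap_wd HS HT HPhi).
- exact: (grmapD HT HPhi).
- exact: (grmapZ HT HPhi).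
- exact: (grmapM HT HPhi ps_neq0 Phi_aug).
- exact: (grmap1 HT HPhi).
- move=> f g ff fg fg_eq.
  have := grmap_wd HT HS HPsi (sfin_gr _ ff) (sfin_gr _ fg) fg_eq.
  move=> e; apply: (eqmod_trans HS (eqmod_sym HS (grPsiPhi _ ff))).
  exact: (eqmod_trans HS e (grPsiPhi _ fg)).
- move=> h fh; exists (grmap Psi h); first exact: (sfin_grmap HPsi).
  exact: grPhiPsi.
- move=> d f ff fd; exists (scomp d (Phi f)); last exact: (grmap_homog HT HPhi).
  by split; [exact: sfin_scomp|move=> a /negbTE ad; rewrite /scomp ad].
- move=> i; apply: (grmap_homog HT HPhi); first exact: sfin_smon.
  by move=> a ai; rewrite /sX smonE; case: eqP => // ea; move: ai; rewrite ea mdeg_mbasis.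
Qed.

End GradedIso.

Section LinearPart.
Variables (k : fieldType) (s t : nat) (ps : 'I_s -> 'I_s -> k) (pt : 'I_t -> 'I_t -> k).
Variables (IS : spoly k s -> Prop) (IT : spoly k t -> Prop) (Phi : spoly k s -> spoly k t).
Hypotheses (HT : graded_ideal pt IT) (HPhi : alg_iso_quot ps pt IS IT Phi).
Hypotheses (ps_neq0 : forall i j, ps i j != 0) (Phi_aug : forall i, chi Phi (sX k i) = 0).
Hypothesis HT2 : ideal_in_ge 2 IT.

Lemma der_linear j u : sfin u -> u mzero = 0 ->
  der Phi j u = \sum_(a < s) u (mbasis a) * der Phi j (sX k a).
Proof.
move=> fu u0.
pose lin a := \sum_(i < s) u (mbasis i) * sX k i a.
have flin : sfin lin.
  exists 1%N => a a1; rewrite /lin big1 // => i _; rewrite /sX smonE.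
  by case: eqP => [ea|]; [move: a1; rewrite ea mdeg_mbasis|rewrite mulr0].
have fu2 : sfin (ssub u lin) by exact: sfinB.
have u2_2 : sge 2 (ssub u lin).
  move=> a; rewrite /ssub /lin; case da: (mdeg a) => [|[|d]] // _.
    rewrite (mdeg_eq0 da) u0 big1 ?subrr // => i _; rewrite /sX smonE.
    by case: eqP => [e|]; [have := mbasis_neq0 i; rewrite e eqxx|rewrite mulr0].
  have [l ->] := mdeg_eq1 da; rewrite (bigD1 l) //= sXE eqxx mulr1 big1 ?addr0 ?subrr //.
  by move=> i /negbTE li; rewrite sXE li mulr0.
have [z [fz z2] Phiu2] := Phi_sge HT HPhi ps_neq0 Phi_aug fu2 u2_2.
have Phiu : eqmod IT (Phi u) (sadd (fun a => \sum_(i < s) u (mbasis i) * Phi (sX k i) a) z).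
  have eu : u = sadd lin (ssub u lin) by apply: spoly_ext => a; rewrite /sadd /ssub; ring.
  rewrite {1}eu; apply: (eqmod_trans HT (ai_add HPhi flin fu2)); apply: (eqmodD HT _ Phiu2).
  by rewrite /lin; apply: (Phi_sum HT HPhi) => i; exact: sfin_smon.
by rewrite /der (coef1_eqmod HT2 _ Phiu) /sadd z2 ?mdeg_mbasis // addr0.
Qed.

End LinearPart.

Section MonomialMatrix.
Variables (k : fieldType) (n m : nat) (L : 'I_n -> 'I_m -> k) (L' : 'I_m -> 'I_n -> k).
Variables (q : 'I_n -> 'I_n -> k) (r : 'I_m -> 'I_m -> k).
Hypothesis q_neq : forall i j, i != j -> q i j != q j i.
Hypothesis LL' : forall i j, \sum_a L i a * L' a j = (i == j)%:R.
Hypothesis L'L : forall a b, \sum_i L' a i * L i b = (a == b)%:R.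
Hypothesis rel_quad : forall a b i j, i != j ->
  q i j * L' b i * L' a j + q j i * L' b j * L' a i
  = r a b * (q i j * L' a i * L' b j + q j i * L' a j * L' b i).
Hypothesis rel_sq : forall a b i, L' b i * L' a i = r a b * (L' a i * L' b i).

Lemma row_support_exists a : exists i, L' a i != 0.
Proof.
apply/existsP; apply: contraT => /existsPn L'a0.
have := L'L a a; rewrite eqxx big1 => [/eqP|i _]; first by rewrite eq_sym oner_eq0.
by have := L'a0 i; rewrite negbK => /eqP ->; rewrite mul0r.
Qed.

(* Rows of [L'] have a single nonzero entry: if row a had two, at i != j, then every
   row b would satisfy L' b i L' a j = L' b j L' a i (using [q_neq] when r a b = 1,
   and [rel_sq] otherwise), contradicting L L' = 1. *)
Lemma row_support_uniq a i j : L' a i != 0 -> L' a j != 0 -> i = j.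
Proof.
move=> ai aj; apply/eqP; apply: contraT => ij.
have cross b : L' b i * L' a j = L' b j * L' a i.
  case: (r a b =P 1) => [rab|/eqP rab].
    have qij : q i j - q j i != 0 by rewrite subr_eq0 q_neq.
    apply/eqP; rewrite -subr_eq0; apply/eqP; apply: (mulfI qij); rewrite mulr0.
    have := rel_quad a b ij; rewrite rab mul1r => rel.
    transitivity ((q i j * L' b i * L' a j + q j i * L' b j * L' a i)
                  - (q i j * L' a i * L' b j + q j i * L' a j * L' b i)); first by ring.
    by rewrite rel subrr.
  have b0 l : L' a l != 0 -> L' b l = 0.
    move=> al; have : (1 - r a b) * (L' a l * L' b l) = 0.
      by rewrite mulrBl mul1r -rel_sq mulrC subrr.
    by move/eqP; rewrite !mulf_eq0 subr_eq0 eq_sym (negbTE rab) (negbTE al) => /eqP.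
  by rewrite (b0 i ai) (b0 j aj) !mul0r.
have : \sum_b L i b * (L' b i * L' a j - L' b j * L' a i) = L' a j.
  rewrite (eq_bigr (fun b => L i b * L' b i * L' a j - L i b * L' b j * L' a i)).
    by rewrite sumrB -!mulr_suml !LL' eqxx (negbTE ij) mul1r mul0r subr0.
  by move=> b _; ring.
by rewrite big1 => [/eqP|b _]; [rewrite eq_sym (negbTE aj)|rewrite cross subrr mulr0].
Qed.

Lemma monomial_of_inverse : exists sigma : 'I_m -> 'I_n,
  [/\ bijective sigma, forall a, L' a (sigma a) != 0,
      forall a j, j != sigma a -> L' a j = 0 &
      forall a b, a != b -> q (sigma b) (sigma a) = r a b * q (sigma a) (sigma b)].
Proof.
pose sigma a := xchoose (row_support_exists a).
have sigmaP a : L' a (sigma a) != 0 := xchooseP (row_support_exists a).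
have L'0 a j : j != sigma a -> L' a j = 0.
  by move=> ja; apply/eqP; apply: contraNT ja => aj; rewrite (row_support_uniq aj (sigmaP a)).
have L'L_sigma a b : \sum_i L' a i * L i b = L' a (sigma a) * L (sigma a) b.
  by rewrite (big_only1 (sigma a)) // => i ia _; rewrite L'0 ?mul0r.
have sigma_inj : injective sigma.
  move=> a b sab; apply/eqP; apply: contraT => ab.
  have := L'L a b; rewrite L'L_sigma (negbTE ab) => /eqP.
  rewrite mulf_eq0 (negbTE (sigmaP a)) sab /= => /eqP Lb0.
  by have := L'L b b; rewrite L'L_sigma Lb0 mulr0 eqxx => /eqP; rewrite eq_sym oner_eq0.
have sigma_surj i : exists a, sigma a == i.
  have [a ai] : exists a, L' a i != 0.
    apply/existsP; apply: contraT => /existsPn L'i0.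
    have := LL' i i; rewrite eqxx big1 => [/eqP|a _]; first by rewrite eq_sym oner_eq0.
    by have := L'i0 a; rewrite negbK => /eqP ->; rewrite mulr0.
  by exists a; rewrite (row_support_uniq ai (sigmaP a)).
pose tau i := xchoose (sigma_surj i).
have tauK : cancel tau sigma := fun i => eqP (xchooseP (sigma_surj i)).
exists sigma; split=> // [|a b ab].
  by apply: inj_card_bij => //; have := leq_card _ (can_inj tauK); rewrite !card_ord.
have sab : sigma a != sigma b by apply: contra ab => /eqP /sigma_inj ->.
have := rel_quad a b sab; rewrite (L'0 b (sigma a) sab) (L'0 a (sigma b)) 1?eq_sym //.
rewrite !mulr0 add0r addr0 => rel.
apply: (mulIf (mulf_neq0 (sigmaP a) (sigmaP b))).
transitivity (q (sigma b) (sigma a) * L' b (sigma b) * L' a (sigma a)); first by ring.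
by rewrite rel; ring.
Qed.

End MonomialMatrix.

Definition elementary_iso (k : fieldType) n m (p : 'I_n -> 'I_n -> k) (p' : 'I_m -> 'I_m -> k)
    (M : spoly k n -> Prop) (N : spoly k m -> Prop) : Prop :=
  n = m /\
  exists sigma : 'I_m -> 'I_n,
    [/\ bijective sigma,
        (forall i j, p' i j = p (sigma i) (sigma j)) &
        exists c : 'I_m -> k,
          (forall i, c i != 0) /\
          exists G : spoly k m -> spoly k n,
            [/\ alg_iso_quot p' p N M G,
                graded_map M G &
                forall i, M (ssub (G (@sX k m i)) (sscale (c i) (@sX k n (sigma i))))]].

Lemma ideal_in_geW (k : fieldType) n d (I : spoly k n -> Prop) :
  ideal_in_ge d.+1 I -> ideal_in_ge d I.
Proof. by move=> Id f If a da; apply: Id If a (ltnW da). Qed.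

Section OneVariable.
Variables (k : fieldType) (ps : 'I_1 -> 'I_1 -> k) (t : nat) (pt : 'I_t -> 'I_t -> k).
Variables (IS : spoly k 1 -> Prop) (IT : spoly k t -> Prop) (Phi : spoly k 1 -> spoly k t).
Hypotheses (HS : graded_ideal ps IS) (HT : graded_ideal pt IT)
  (HPhi : alg_iso_quot ps pt IS IT Phi) (HT2 : ideal_in_ge 2 IT).
Hypothesis ps_neq0 : forall i j, ps i j != 0.

(* If the character [chi Phi] does not kill x, it kills no power of x, so a graded
   ideal on which it vanishes is zero. *)
Lemma onevar_ideal_eq0 f : chi Phi (sX k ord0) != 0 -> IS f -> f = @szero k 1.
Proof.
move=> chiX If.
have chi_smon a : chi Phi (smon k a) != 0.
  elim: {a}(mdeg a) {-2}a (erefl (mdeg a)) => [|d IH] a da.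
    by rewrite (mdeg_eq0 da) -/(@sone k 1) (chi1 HPhi HT2) oner_eq0.
  have [|i [b [eab db]]] := mdeg_decomp (a := a); first by rewrite da.
  have fb := sfin_smon k b; have fX := sfin_smon k (mbasis i).
  rewrite eab (smon_madd ps_neq0) (chiZ HPhi HT2); last exact: sfinM.
  rewrite (chiM HPhi HT2) // (ord1 i) !mulf_neq0 ?invr_eq0 ?twist_neq0 //.
  by apply: IH; rewrite db da.
apply: spoly_ext => a; rewrite /szero.
have Ia := gi_graded HS (mdeg a) If.
have Ea : scomp (mdeg a) f = sscale (f a) (smon k a).
  apply: spoly_ext => b; rewrite /scomp /sscale smonE; case: eqP => db.
    have -> : b = a by apply/ffunP => i; move: db; rewrite (ord1 i) /mdeg !big_ord1.
    by rewrite eqxx mulr1.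
  by case: eqP => [ba|]; [case: db; rewrite ba|rewrite mulr0].
move: (chi_ideal HS HT HPhi HT2 Ia); rewrite Ea (chiZ HPhi HT2); last exact: sfin_smon.
by move/eqP; rewrite mulf_eq0 (negbTE (chi_smon a)) orbF => /eqP.
Qed.

End OneVariable.

Section DimensionOne.
Variables (k : fieldType) (p p' : 'I_1 -> 'I_1 -> k).
Variables (M N : spoly k 1 -> Prop) (F G : spoly k 1 -> spoly k 1).
Hypotheses (Hp : skew_params p) (Hp' : skew_params p').
Hypotheses (HM : graded_ideal p M) (HM2 : ideal_in_ge 2 M).
Hypotheses (HN : graded_ideal p' N) (HN2 : ideal_in_ge 2 N).
Hypotheses (HF : alg_iso_quot p p' M N F) (HG : alg_iso_quot p' p N M G).
Hypothesis GF : forall f, sfin f -> eqmod M (G (F f)) f.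
Hypothesis chiFX : chi F (sX k ord0) != 0.

(* Otherwise [chi G] would be the augmentation, and [chi G (F x)] = [(F x)(0)] would vanish. *)
Let chiGX : chi G (sX k ord0) != 0.
Proof.
apply: contra chiFX => /eqP chiGX0.
have fX := sfin_smon k (mbasis (@ord0 0)); have fFX := ai_fin HF fX.
have chiG0 i : chi G (sX k i) = 0 by rewrite (ord1 i).
rewrite /chi -(character_augmentation (skew_neq0 Hp') (chi1 HG HM2) (chiD HG HM2)
  (chiZ HG HM2) (chiM HG HM2) chiG0 fFX).
rewrite /chi (eqmod_coef_low HM2 (GF fX)) ?mdeg_mzero // smonE.
by rewrite [_ == mbasis _]eq_sym (negbTE (mbasis_neq0 _)).
Qed.

Lemma elementary_iso_dim1 : elementary_iso p p' M N.
Proof.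
have M0 f : M f -> f = @szero k 1.
  by move=> Mf; apply: (onevar_ideal_eq0 HM HN HF HN2 (skew_neq0 Hp)).
have N0 f : N f -> f = @szero k 1.
  by move=> Nf; apply: (onevar_ideal_eq0 HN HM HG HM2 (skew_neq0 Hp') chiGX).
have subff (f : spoly k 1) : ssub f f = @szero k 1.
  by apply: spoly_ext => a; rewrite /ssub subrr.
have -> : p' = p.
  apply: functional_extensionality => i; apply: functional_extensionality => j.
  by rewrite (ord1 i) (ord1 j) (skew_diag Hp) (skew_diag Hp').
have N_0 := gi_zero HN; have M_0 := gi_zero HM.
split=> //; exists id; split=> //; first by exists id.
exists (fun=> 1); split=> [i|]; first exact: oner_neq0.
exists id; split.
- split=> // [f g _ _ /N0 ->|f g _ _|x f _|f g _ _||f g _ _ /M0 ->|h fh];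
    rewrite ?subff //.
  by exists h; rewrite ?subff.
- by move=> d f ff fd; exists f; rewrite ?subff.
- move=> i; have -> : sscale 1 (sX k (id i)) = sX k i.
    by apply: spoly_ext => a; rewrite /sscale mul1r.
  by rewrite subff.
Qed.

End DimensionOne.

Section Classification.
Variables (k : fieldType) (n m : nat) (p : 'I_n -> 'I_n -> k) (p' : 'I_m -> 'I_m -> k).
Variables (M : spoly k n -> Prop) (N : spoly k m -> Prop).
Variables (F : spoly k n -> spoly k m) (G : spoly k m -> spoly k n).
Hypotheses (Hp : skew_params p) (Hp' : skew_params p').
Hypothesis p_neq1 : forall i j, i != j -> p i j != 1.
Hypotheses (HM : graded_ideal p M) (HM3 : ideal_in_ge 3 M).
Hypotheses (HN : graded_ideal p' N) (HN2 : ideal_in_ge 2 N).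
Hypotheses (HF : alg_iso_quot p p' M N F) (HG : alg_iso_quot p' p N M G).
Hypotheses (FG : forall h, sfin h -> eqmod N (F (G h)) h)
  (GF : forall f, sfin f -> eqmod M (G (F f)) f).

Let HM2 : ideal_in_ge 2 M := ideal_in_geW HM3.

Lemma source_dim_le1 : (0 < m)%N -> (m <= 1)%N -> (n <= 1)%N.
Proof.
move=> m_gt0 m_le1.
apply: (embdim_le1 HG HM2 (ai_fin HF) GF (skew_neq0 Hp') (i0 := Ordinal m_gt0)).
by move=> b j /eqP []; apply: val_inj; have := ltn_ord j; rewrite /=; lia.
Qed.

(* From x_j x_i0 = p_i0j x_i0 x_j with p_i0j != 1, first [chi F] and then every
   [der F b] vanish at x_j as soon as [chi F] does not vanish at x_i0. *)
Lemma der_skew_generator i0 j b : chi F (sX k i0) != 0 -> j != i0 -> der F b (sX k j) = 0.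
Proof.
move=> chi_i0 ji0.
have fXj := sfin_smon k (mbasis j); have fXi0 := sfin_smon k (mbasis i0).
have fXX := sfinM p fXi0 fXj.
have p1 : 1 - p i0 j != 0 by rewrite subr_eq0 eq_sym p_neq1 // eq_sym.
have chi_j : chi F (sX k j) = 0.
  have := chiM HF HN2 fXj fXi0; rewrite (smulXC Hp) (chiZ HF HN2) // (chiM HF HN2) // => e.
  have : (1 - p i0 j) * (chi F (sX k i0) * chi F (sX k j)) = 0.
    by rewrite mulrBl mul1r e mulrC subrr.
  by move/eqP; rewrite !mulf_eq0 (negbTE p1) (negbTE chi_i0) => /eqP.
have := derM HF HN2 b fXj fXi0; rewrite (smulXC Hp) (derZ HF HN2) // (derM HF HN2) //.
rewrite chi_j mul0r addr0 mulr0 add0r => e.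
have : (1 - p i0 j) * (chi F (sX k i0) * der F b (sX k j)) = 0.
  by rewrite mulrBl mul1r e [der F b _ * _]mulrC subrr.
by move/eqP; rewrite !mulf_eq0 (negbTE p1) (negbTE chi_i0) => /eqP.
Qed.

Lemma target_dim_le1 i0 : chi F (sX k i0) != 0 -> (m <= 1)%N.
Proof.
move=> chi_i0; apply: (embdim_le1 HF HN2 (ai_fin HG) FG (skew_neq0 Hp) (i0 := i0)).
by move=> b j; exact: der_skew_generator.
Qed.

Lemma chi_generators_dichotomy : (0 < n)%N -> (0 < m)%N ->
  (forall i, chi F (sX k i) = 0) \/ [/\ n = 1%N, m = 1%N & exists i, chi F (sX k i) != 0].
Proof.
move=> n_gt0 m_gt0.
have [i0 chi_i0|chi0] := pickP (fun i => chi F (sX k i) != 0); last first.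
  by left=> i; apply/eqP; have := chi0 i; move/negbFE.
have m1 : m = 1%N by have := target_dim_le1 chi_i0; lia.
by right; split=> //; [have := source_dim_le1 m_gt0; lia|exists i0].
Qed.

Hypothesis F_aug : forall i, chi F (sX k i) = 0.

Lemma chiF_aug f : sfin f -> chi F f = f mzero.
Proof.
exact: (character_augmentation (skew_neq0 Hp) (chi1 HF HN2) (chiD HF HN2) (chiZ HF HN2)
  (chiM HF HN2) F_aug).
Qed.

Lemma G_aug a : chi G (sX k a) = 0.
Proof.
have fX := sfin_smon k (mbasis a).
rewrite /chi -chiF_aug; last exact: (ai_fin HG).
rewrite /chi (eqmod_coef_low HN2 (FG fX)) ?mdeg_mzero // smonE.
by rewrite [_ == mbasis _]eq_sym (negbTE (mbasis_neq0 _)).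
Qed.

(* The linear parts of F and G, as matrices: x_i |-> sum_a L i a y_a, y_a |-> sum_i L' a i x_i. *)
Let L i a := der F a (sX k i).
Let L' a i := der G i (sX k a).

Lemma linear_parts_inverse : (forall i j, \sum_a L i a * L' a j = (i == j)%:R)
  /\ (forall a b, \sum_i L' a i * L i b = (a == b)%:R).
Proof.
split=> [i j|a b].
- have fX : sfin (sX k i) := sfin_smon k (mbasis i).
  rewrite /L /L' -(der_linear HM HG (skew_neq0 Hp') G_aug HM2 j (ai_fin HF fX) (F_aug i)).
  by rewrite /der (coef1_eqmod HM2 _ (GF fX)) sXE.
- have fX : sfin (sX k a) := sfin_smon k (mbasis a).
  rewrite /L /L' -(der_linear HN HF (skew_neq0 Hp) F_aug HN2 b (ai_fin HG fX) (G_aug a)).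
  by rewrite /der (coef1_eqmod HN2 _ (FG fX)) sXE.
Qed.

Lemma G_skew_rel a b : eqmod M (smul p (G (sX k b)) (G (sX k a)))
  (sscale (p' a b) (smul p (G (sX k a)) (G (sX k b)))).
Proof.
have fa := sfin_smon k (mbasis a); have fb := sfin_smon k (mbasis b).
apply: (eqmod_trans HM (eqmod_sym HM (ai_mul HG fb fa))); rewrite (smulXC Hp' a b).
apply: (eqmod_trans HM (ai_scale HG _ (sfinM _ fa fb))).
exact: (eqmodZ HM _ (ai_mul HG fa fb)).
Qed.

Let q i j := twist p (mbasis i) (mbasis j).

(* Degree-2 coefficients of [G_skew_rel]; they survive since M lies in degrees >= 3. *)
Lemma linear_part_rel :
  (forall a b i j, i != j ->
     q i j * L' b i * L' a j + q j i * L' b j * L' a i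
     = p' a b * (q i j * L' a i * L' b j + q j i * L' a j * L' b i))
  /\ (forall a b i, L' b i * L' a i = p' a b * (L' a i * L' b i)).
Proof.
have G1 c : sge 1 (G (sX k c)).
  by move=> x; rewrite ltnS leqn0 => /eqP /mdeg_eq0 ->; exact: G_aug.
split=> [a b i j ij|a b i].
- have := eqmod_coef_low (a := madd (mbasis i) (mbasis j)) HM3 (G_skew_rel a b).
  by rewrite mdegD !mdeg_mbasis /sscale !smul_at_quad //; exact.
- have := eqmod_coef_low (a := madd (mbasis i) (mbasis i)) HM3 (G_skew_rel a b).
  by rewrite mdegD !mdeg_mbasis /sscale !smul_at_sq //; exact.
Qed.

Lemma q_neq i j : i != j -> q i j != q j i.
Proof.
move=> ij; rewrite /q (twist_mbasisC Hp i j); apply: contra (p_neq1 ij) => /eqP e.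
apply/eqP; apply: (mulIf (twist_neq0 (mbasis i) (mbasis j) (skew_neq0 Hp))).
by rewrite mul1r -e.
Qed.

Lemma elementary_iso_aug : elementary_iso p p' M N.
Proof.
have [LL' L'L] := linear_parts_inverse; have [rel_quad rel_sq] := linear_part_rel.
have [sigma [sigma_bij L'_sigma L'0 q_sigma]] :=
  monomial_of_inverse q_neq LL' L'L rel_quad rel_sq.
have [grG_iso grG_graded grGX] :=
  grmap_iso HN HM HG HF (skew_neq0 Hp') (skew_neq0 Hp) G_aug F_aug GF FG.
split; first by have := bij_eq_card sigma_bij; rewrite !card_ord.
exists sigma; split=> // [a b|].
  have [<-|ab] := eqVneq a b; first by rewrite !skew_diag.
  apply: (mulIf (twist_neq0 (mbasis (sigma a)) (mbasis (sigma b)) (skew_neq0 Hp))).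
  by have := q_sigma a b ab; rewrite /q twist_mbasisC.
exists (fun a => L' a (sigma a)); split=> //; exists (grmap G); split=> // a.
apply: (eqmod_trans HM (grGX a)); apply: (eqmod_eq HM); apply: spoly_ext => x.
rewrite /scomp /sscale; case: eqP => [/mdeg_eq1 [l ->]|x1]; last first.
  by rewrite /sX smonE; case: eqP => [ex|]; [case: x1; rewrite ex mdeg_mbasis|rewrite mulr0].
rewrite sXE; have [->|l_sigma] := eqVneq l (sigma a); first by rewrite mulr1.
by rewrite mulr0; exact: L'0.
Qed.

End Classification.

Theorem theorem0p4 (k : fieldType) (n m : nat)
  (p : 'I_n -> 'I_n -> k) (p' : 'I_m -> 'I_m -> k)
  (M : spoly k n -> Prop) (N : spoly k m -> Prop) :
  (0 < n)%N -> (0 < m)%N ->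
  skew_params p -> skew_params p' ->
  (forall i j : 'I_n, i != j -> p i j != 1) ->
  graded_ideal p M -> ideal_in_ge 3 M ->
  graded_ideal p' N -> ideal_in_ge 2 N ->
  (exists F : spoly k n -> spoly k m, alg_iso_quot p p' M N F) ->
  n = m /\
  exists sigma : 'I_m -> 'I_n,
    [/\ bijective sigma,
        (forall i j, p' i j = p (sigma i) (sigma j)) &
        exists c : 'I_m -> k,
          (forall i, c i != 0) /\
          exists G : spoly k m -> spoly k n,
            [/\ alg_iso_quot p' p N M G,
                graded_map M G &
                forall i, M (ssub (G (@sX k m i)) (sscale (c i) (@sX k n (sigma i))))]].
Proof.
move=> n_gt0 m_gt0 Hp Hp' p_neq1 HM HM3 HN HN2 [F HF].
have [G [HG FG GF]] := alg_iso_quot_inv HN HF.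
have [F_aug|[n1 m1 [i0 chi_i0]]] :=
  chi_generators_dichotomy Hp Hp' p_neq1 HM3 HN2 HF HG FG GF n_gt0 m_gt0.
  exact: (elementary_iso_aug Hp Hp' p_neq1 HM HM3 HN HN2 HF HG FG GF F_aug).
subst n m; rewrite (ord1 i0) in chi_i0.
exact: (elementary_iso_dim1 Hp Hp' HM (ideal_in_geW HM3) HN HN2 HF HG GF chi_i0).
Qed.
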